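(* Let $\phi$ be an elliptical base density on $\mathbb{R}^d$, $\phi(w)=\psi(w^\top w)$ for a function $\psi:\mathbb{R}\to\mathbb{R}$, that is positive, twice continuously differentiable and has a finite first-order moment, and set $\rho(z)=2\psi'(z)/\psi(z)$. Given transition data $(x_i,x_i')\in\mathbb{R}^d\times\mathbb{R}^d$, $i=1,\dots,N$, let $(\hat A_{\mathrm{mle}},\hat\varSigma_{\mathrm{mle}})$ be the maximum likelihood estimator with respect to the family $\{f_{A,\varSigma}\}$ with base density $\phi$, and put $$\rho_i=\rho\Big(\big(x_i'-\hat A_{\mathrm{mle}}x_i\big)^\top\hat\varSigma_{\mathrm{mle}}^{-1}\big(x_i'-\hat A_{\mathrm{mle}}x_i\big)\Big),\quad i=1,\dots,N.$$ Assume that $-\sum_{i=1}^N\rho_ix_ix_i^\top\succ0$ (positive definite). Then $$\hat A_{\mathrm{mle}}=\Big(\sum_{i=1}^N\rho_ix_i'x_i^\top\Big)\Big(\sum_{i=1}^N\rho_ix_ix_i^\top\Big)^{-1},\qquad \hat\varSigma_{\mathrm{mle}}=-\frac1N\sum_{i=1}^N\rho_i\big(x_i'-\hat A_{\mathrm{mle}}x_i\big)\big(x_i'-\hat A_{\mathrm{mle}}x_i\big)^\top.$$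
   Context: For $A\in\mathbb{R}^{d\times d}$ and $\varSigma$ symmetric positive definite, $f_{A,\varSigma}(x'|x)=\det(\varSigma)^{-1/2}\phi\big(\varSigma^{-1/2}(x'-Ax)\big)$ for $x,x'\in\mathbb{R}^d$. The maximum likelihood estimator is $(\hat A_{\mathrm{mle}},\hat\varSigma_{\mathrm{mle}})\in\arg\max_{A,\varSigma}\frac1N\sum_{i=1}^N\log f_{A,\varSigma}(x_i'|x_i)$ over $A\in\mathbb{R}^{d\times d}$ and symmetric positive definite $\varSigma$. *)

(* Defs.v *)
From HB Require Import structures.
From mathcomp Require Import all_boot all_order all_algebra.
From mathcomp Require Import all_classical all_reals all_analysis.

Set Implicit Arguments.
Unset Strict Implicit.
Unset Printing Implicit Defensive.

Import Order.TTheory GRing.Theory Num.Theory.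
Import numFieldNormedType.Exports.

Local Open Scope classical_set_scope.
Local Open Scope ring_scope.

(* The n-fold power of a sigma-finite measure, on n-tuples with the product
   sigma-algebra: the binary product is iterated, and its image under
   [cons_pair] identifies T * T^n with T^n.+1. *)
Section power_measure.
Context d (T : measurableType d) (R : realType).
Variable m : {sigma_finite_measure set T -> \bar R}.

Definition cons_pair (n : nat) (p : T * n.-tuple T) : n.+1.-tuple T :=
  [tuple of p.1 :: p.2].

Lemma measurable_cons_pair (n : nat) : measurable_fun setT (@cons_pair n).
Proof. by apply: measurable_cons. Qed.

Section power_measure_step.
Context (n : nat) (mu : {sigma_finite_measure set (n.-tuple T) -> \bar R}).

Definition cons_measure : set (n.+1.-tuple T) -> \bar R :=
  pushforward (m \x mu)%E (@cons_pair n).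

Let cons_measureM : {measure set (n.+1.-tuple T) -> \bar R} :=
  measure_function_pushforward__canonical__measure_function_Measure
    (m \x mu)%E (@measurable_cons_pair n).

HB.instance Definition _ := isMeasure.Build _ _ _ cons_measure
  (measure0 cons_measureM) (measure_ge0 cons_measureM)
  (@measure_semi_sigma_additive _ _ _ cons_measureM).

Lemma cons_measure_sigma_finite : sigma_finite setT cons_measure.
Proof.
have /sigma_finiteP[F [TF ndF Foo]] := sigma_finiteT m.
have /sigma_finiteP[G [TG ndG Goo]] := sigma_finiteT mu.
pose bh (t : n.+1.-tuple T) : n.-tuple T := [tuple of behead t].
pose A k : set (n.+1.-tuple T) :=
  (fun t => thead t) @^-1` F k `&` bh @^-1` G k.
have AE k : @cons_pair n @^-1` A k = F k `*` G k.
  apply/seteqP; split=> -[a t];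
    rewrite /A /= theadE (_ : bh (cons_pair (a, t)) = t) //; exact/val_inj.
exists A.
  apply/seteqP; split=> // t _.
  have [i _ Fi] : (\bigcup_k F k) (thead t) by rewrite -TF.
  have [j _ Gj] : (\bigcup_k G k) (bh t) by rewrite -TG.
  exists (maxn i j) => //; split => /=.
    by move: (thead t) Fi; exact/subsetPset/ndF/leq_maxl.
  by move: (bh t) Gj; exact/subsetPset/ndG/leq_maxr.
move=> k; have [mF Fk] := Foo k; have [mG Gk] := Goo k; split.
  apply: measurableI; rewrite -[X in measurable X]setTI.
    exact: measurable_tnth.
  exact: measurable_behead.
rewrite /cons_measure /pushforward AE product_measure1E//.
by rewrite lte_mul_pinfty// ge0_fin_numE.
Qed.

HB.instance Definition _ := Measure_isSigmaFinite.Build _ _ _ cons_measure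
  cons_measure_sigma_finite.

End power_measure_step.

Fixpoint power_measure (n : nat) :
    {sigma_finite_measure set (n.-tuple T) -> \bar R} :=
  match n with
  | 0 => \d_([tuple] : 0.-tuple T)
  | n'.+1 => cons_measure (power_measure n')
  end.

End power_measure.

Section vectors.
Context {R : realType} (d : nat).

Definition lebesgue_tuple :
    {sigma_finite_measure set (d.-tuple (measurableTypeR R)) -> \bar R} :=
  power_measure (@lebesgue_measure R) d.

Definition col_of_tuple (t : d.-tuple (measurableTypeR R)) : 'cV[R]_d :=
  \col_(i < d) tnth t i.

Definition quad_form (M : 'M[R]_d) (v : 'cV[R]_d) : R := (v^T *m M *m v) 0 0.

Definition sq_norm (v : 'cV[R]_d) : R := (v^T *m v) 0 0.

Definition posdefmx (M : 'M[R]_d) : Prop :=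
  M^T = M /\ forall v : 'cV[R]_d, v != 0 -> 0 < quad_form M v.

(* The symmetric positive definite square root of a symmetric positive
   definite matrix; it exists and is unique. *)
Definition sqrtmx (M : 'M[R]_d) : 'M[R]_d :=
  xget 0 [set B | posdefmx B /\ B *m B = M].

(* A probability density with respect to Lebesgue measure. *)
Definition is_density (p : 'cV[R]_d -> R) : Prop :=
  [/\ measurable_fun setT (p \o col_of_tuple),
      forall w, 0 <= p w &
      (\int[lebesgue_tuple]_t (p (col_of_tuple t))%:E = 1)%E].

Definition finite_first_moment (p : 'cV[R]_d -> R) : Prop :=
  (\int[lebesgue_tuple]_t
     (Num.sqrt (sq_norm (col_of_tuple t)) * p (col_of_tuple t))%:E < +oo)%E.

(* C^k on R^d: all partial derivatives of order at most k exist and are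
   continuous. *)
Fixpoint continuously_differentiable (k : nat) (p : 'cV[R]_d -> R) : Prop :=
  continuous p /\
  match k with
  | 0 => True
  | k'.+1 => forall i : 'I_d,
      (forall w, derivable p w (delta_mx i 0)) /\
      continuously_differentiable k' (fun w => 'D_(delta_mx i 0) p w)
  end.

Definition elliptical (p : 'cV[R]_d -> R) (psi : R -> R) : Prop :=
  forall w, p w = psi (sq_norm w).

Definition transition_density (phi : 'cV[R]_d -> R) (A S : 'M[R]_d)
    (x' x : 'cV[R]_d) : R :=
  (\det S) `^ (- 2^-1) * phi (invmx (sqrtmx S) *m (x' - A *m x)).

Definition mean_loglik (phi : 'cV[R]_d -> R) (N : nat)
    (x x' : 'I_N -> 'cV[R]_d) (A S : 'M[R]_d) : R :=
  N%:R^-1 * \sum_(i < N) ln (transition_density phi A S (x' i) (x i)).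

Definition is_mle (phi : 'cV[R]_d -> R) (N : nat)
    (x x' : 'I_N -> 'cV[R]_d) (A S : 'M[R]_d) : Prop :=
  posdefmx S /\
  forall A0 S0 : 'M[R]_d, posdefmx S0 ->
    mean_loglik phi x x' A0 S0 <= mean_loglik phi x x' A S.

End vectors.

(* The elliptical representation constrains [psi] on [0, +oo[ only, so at 0 the
   two-sided derivative is the intended one provided that [psi] is
   differentiable there; otherwise it is an arbitrary value. *)
Definition rho {R : realType} (psi : R -> R) (z : R) : R :=
  2 * derive1 psi z / psi z.

(* Main.v *)
Require Import Defs.
From mathcomp Require Import all_boot all_order all_algebra.
From mathcomp Require Import all_classical all_reals all_analysis.
From mathcomp Require Import complex ring lra.
Import Order.TTheory GRing.Theory Num.Theory.
Import numFieldNormedType.Exports.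
Local Open Scope classical_set_scope.
Local Open Scope ring_scope.

(* Up to an additive constant, the log-likelihood at (A0, S0) is
   sum_i (ln psi(q_i) - ln (det S0) / 2), where q_i is the value of the form
   S0^-1 at x'_i - A0 x_i. No matrix calculus is needed: at a maximizer (A, S)
   the derivative vanishes along the line A + t H with H = S (sum_i rho_i r_i
   x_i^T), which forces sum_i rho_i r_i x_i^T = 0, and along the curves
   S0^-1 = S^-1 + t v v^T, where det (S0^-1) = det (S^-1) (1 + t v^T S v) and
   the q_i are affine in t, which determines v^T S v for every v. *)

(** * Quadratic forms and positive definite matrices *)

Lemma trmx11 (R : pzRingType) (M : 'M[R]_1) : M^T 0 0 = M 0 0.
Proof. by rewrite mxE. Qed.

Section quadratic_forms.
Context {R : realType} {d : nat}.
Implicit Types (M P B : 'M[R]_d) (u v : 'cV[R]_d).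

Lemma sq_normE v : sq_norm v = \sum_i v i 0 ^+ 2.
Proof. by rewrite /sq_norm mxE; apply: eq_bigr => i _; rewrite mxE expr2. Qed.

Lemma sq_norm_ge0 v : 0 <= sq_norm v.
Proof. by rewrite sq_normE sumr_ge0// => i _; rewrite sqr_ge0. Qed.

Lemma sq_norm_eq0 v : (sq_norm v == 0) = (v == 0).
Proof.
apply/eqP/eqP => [|->]; last by rewrite /sq_norm mulmx0 mxE.
rewrite sq_normE => /psumr_eq0P H; apply/matrixP => i j; rewrite mxE ord1.
by apply/eqP; rewrite -sqrf_eq0 H// => k _; rewrite sqr_ge0.
Qed.

Lemma sq_norm_gt0 v : (0 < sq_norm v) = (v != 0).
Proof. by rewrite lt0r sq_norm_eq0 sq_norm_ge0 andbT. Qed.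

Lemma quad_form_trmul M v : quad_form (M^T *m M) v = sq_norm (M *m v).
Proof. by rewrite /quad_form /sq_norm trmx_mul !mulmxA. Qed.

Lemma quad_form0 M : quad_form M 0 = 0.
Proof. by rewrite /quad_form mulmx0 mxE. Qed.

Lemma posdefmx_ge0 M v : posdefmx M -> 0 <= quad_form M v.
Proof.
by case=> _ Mpos; have [->|/Mpos/ltW//] := eqVneq v 0; rewrite quad_form0.
Qed.

Lemma posdefmx_unit M : posdefmx M -> M \in unitmx.
Proof.
move=> [_ Mpos]; rewrite unitmxE unitfE; apply/negP => /det0P[v v0 vM].
have := Mpos v^T; rewrite trmx_eq0 => /(_ v0).
by rewrite /quad_form trmxK vM mul0mx mxE ltxx.
Qed.

Lemma posdefmx_inv M : posdefmx M -> posdefmx (invmx M).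
Proof.
move=> Mpd; have Mu := posdefmx_unit _ Mpd; have [Mt Mpos] := Mpd.
split=> [|v v0]; first by rewrite trmx_inv Mt.
have := Mpos (invmx M *m v); rewrite /quad_form trmx_mul trmx_inv Mt.
rewrite -!mulmxA (mulmxA M) mulmxV// mul1mx; apply.
by apply: contraNneq v0 => /(congr1 (mulmx M)); rewrite mulKVmx// mulmx0 => ->.
Qed.

Lemma quad_formD M P v : quad_form (M + P) v = quad_form M v + quad_form P v.
Proof. by rewrite /quad_form mulmxDr mulmxDl mxE. Qed.

Lemma quad_formZ a M v : quad_form (a *: M) v = a * quad_form M v.
Proof. by rewrite /quad_form -scalemxAr -scalemxAl mxE. Qed.

Lemma quad_formN M v : quad_form (- M) v = - quad_form M v.
Proof. by rewrite -scaleN1r quad_formZ mulN1r. Qed.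

Lemma quad_form_sum (I : finType) (M : I -> 'M[R]_d) v :
  quad_form (\sum_i M i) v = \sum_i quad_form (M i) v.
Proof.
apply: (big_morph (fun M => quad_form M v)) => [N P|]; first exact: quad_formD.
by rewrite /quad_form mulmx0 mul0mx mxE.
Qed.

Lemma quad_form_rank1 u v : quad_form (u *m u^T) v = ((u^T *m v) 0 0) ^+ 2.
Proof.
rewrite /quad_form mulmxA -mulmxA mxE big_ord1 expr2; congr (_ * _).
by rewrite -trmx11 trmx_mul trmxK.
Qed.

Lemma quad_formDr M u v : M^T = M ->
  quad_form M (u + v) = quad_form M u + 2 * (u^T *m M *m v) 0 0 + quad_form M v.
Proof.
move=> Mt; rewrite /quad_form [(_ + _)^T]linearD /= mulmxDr !mulmxDl.
rewrite mxE [X in X + _ = _]mxE [X in _ + X = _]mxE.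
have -> : (v^T *m M *m u) 0 0 = (u^T *m M *m v) 0 0.
  by rewrite -trmx11 !trmx_mul trmxK Mt mulmxA.
ring.
Qed.

Lemma quad_formZr M a v : quad_form M (a *: v) = a ^+ 2 * quad_form M v.
Proof.
by rewrite /quad_form [(_ *: _)^T]linearZ /= -scalemxAr -!scalemxAl !mxE; ring.
Qed.

(** Polarization: the values at sums of two basis vectors recover the entries. This identifies [S]
    once [v^T S v] is known for every [v]. *)
Lemma quad_form_inj M P : M^T = M -> P^T = P ->
  (forall v, quad_form M v = quad_form P v) -> M = P.
Proof.
move=> Mt Pt MP; apply/matrixP => i j.
have E (Q : 'M[R]_d) k l :
    ((delta_mx k 0 : 'cV_d)^T *m Q *m (delta_mx l 0 : 'cV_d)) 0 0 = Q k l.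
  by rewrite trmx_delta -rowE -colE !mxE.
have := MP (delta_mx i 0 + delta_mx j 0).
rewrite !quad_formDr// !MP !E; lra.
Qed.

(* [S v] attains equality in Cauchy-Schwarz for the form [S^-1]. *)
Lemma posdefmx_rank1_update M v t : posdefmx M ->
  0 < 1 + t * quad_form M v -> posdefmx (invmx M + t *: (v *m v^T)).
Proof.
move=> Mpd tq; have Mu := posdefmx_unit _ Mpd.
have iMpd := posdefmx_inv _ Mpd; have [Mt Mpos] := Mpd.
have [iMt iMpos] := iMpd.
split=> [|y y0].
  by rewrite [LHS]linearD /= [(_ *: _)^T]linearZ /= trmx_mul trmxK iMt.
rewrite quad_formD quad_formZ quad_form_rank1.
have [->|v0] := eqVneq v 0.
  by rewrite trmx0 mul0mx mxE expr0n mulr0 addr0 iMpos.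
set q := quad_form M v in tq; have q0 : 0 < q by exact: Mpos.
set b : R := (v^T *m y) 0 0.
have a0 := iMpos _ y0; set a := quad_form _ y in a0 *.
have : b ^+ 2 <= a * q.
  (* [b / q] is the coefficient of the projection of [y] on [M *m v] for the form [invmx M]; the
     form takes the value [a - b ^+ 2 / q] at the remainder. *)
  have := posdefmx_ge0 _ (- (b / q) *: (M *m v) + y) iMpd.
  rewrite quad_formDr// quad_formZr [(_ *: _)^T]linearZ /= trmx_mul Mt.
  rewrite -!scalemxAl -!mulmxA.
  rewrite mxE (mulmxA M) mulmxV// mul1mx -/b -/a.
  have -> : quad_form (invmx M) (M *m v) = q.
    by rewrite /q /quad_form trmx_mul Mt -!mulmxA mulKmx.
  have -> : (- (b / q)) ^+ 2 * q + 2 * (- (b / q) * b) + a = a - b ^+ 2 / q.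
    by field; exact: lt0r_neq0.
  by rewrite subr_ge0 ler_pdivrMr.
(* For negative [t], [a + t * b ^+ 2] is at least [a * (1 + t * q)]. *)
move: (sqr_ge0 b) => {}b0 ab; have [t0|t0] := leP 0 t;
  clear -tq q0 b0 ab a0 t0; nra.
Qed.

End quadratic_forms.

(** * Matrix square roots and determinants *)

Lemma interpolation (F : fieldType) (rs : seq F) (g : F -> F) :
  exists p : {poly F}, {in rs, forall a, p.[a] = g a}.
Proof.
elim: rs => [|a rs [p IH]]; first by exists 0.
have [ars|ars] := boolP (a \in rs).
  by exists p => b; rewrite inE => /predU1P[->|]; exact: IH.
(* Newton's scheme: [w] vanishes at the earlier nodes, so adding a multiple of it adjusts the value
   at [a] and keeps theirs. *)
pose w := \prod_(c <- rs) ('X - c%:P).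
have wa : w.[a] != 0 by rewrite -[_ == 0]/(root w a) root_prod_XsubC.
exists (p + ((g a - p.[a]) / w.[a]) *: w) => b.
rewrite inE !hornerE => /predU1P[->|brs]; first by rewrite divfK// addrC subrK.
by rewrite (rootP (_ : root w b)) ?root_prod_XsubC// mulr0 addr0 IH.
Qed.

(** Makes polynomials in a symmetric matrix symmetric. Transposition reverses products, which is
    harmless because powers of one matrix commute. *)
Lemma trmx_horner_mx (R : comNzRingType) n (M : 'M[R]_n.+1) p :
  (horner_mx M p)^T = horner_mx M^T p.
Proof.
elim/poly_ind: p => [|p c IH]; first by rewrite !rmorph0 trmx0.
rewrite !rmorphD !rmorphM /= !horner_mx_X !horner_mx_C linearD /= tr_scalar_mx.
congr (_ + _); rewrite trmx_mul IH.
exact/esym/comm_horner_mx/erefl.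
Qed.

Section square_root.
Context {R : realType}.

(* Eigenvalues of the complexification are real, and hence already
   eigenvalues over R, where positive definiteness makes them positive. *)
Lemma posdefmx_spectrum n (S : 'M[R]_n.+1) : posdefmx S ->
  exists rs : seq R, (forall a, a \in rs -> 0 < a) /\
    forall p : {poly R}, {in rs, forall a, p.[a] = 0} -> horner_mx S p = 0.
Proof.
move=> [St Spos]; pose f := real_complex R; pose SC := map_mx f S.
(* Being real and symmetric, [SC] is Hermitian, hence unitarily diagonalizable with real
   spectrum. *)
have SCr : SC \is a mxOver Num.real.
  by apply/mxOverP => i j; rewrite mxE; apply/complex_realP; exists (S i j).
have SCs : SC \is symmetricmx.
  apply/is_hermitianmxP; rewrite expr0 scale1r map_mx_id//.
  by rewrite /SC map_trmx St.
have SCh := realsym_hermsym SCs SCr.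
have SCE := orthomx_spectralP (hermitian_normalmx SCh).
have spr := hermitian_spectral_diag_real SCh.
set P := spectralmx SC in SCE; set sp := spectral_diag SC in SCE spr.
have Pu : P \in unitmx by exact: spectral_unit.
pose l i := complex.Re (sp 0 i).
have lE i : f (l i) = sp 0 i.
  by rewrite /l /f RRe_real//; have /mxOverP := spr; exact.
exists [seq l i | i <- enum 'I_n.+1]; split=> [a /mapP[i _ ->]|p pl].
  have : eigenvalue SC (sp 0 i).
    apply/eigenvalueP; exists (row i P).
      rewrite -row_mul SCE mulmxA mulKVmx//.
      by rewrite mul_diag_mx; apply/rowP => j; rewrite !mxE.
    by rewrite rowE mulmx_free_eq0 ?row_free_unit//; apply/eqP =>
       /matrixP/(_ 0 i)/eqP; rewrite !mxE !eqxx oner_eq0.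
  rewrite eigenvalue_root_char -lE -map_char_poly fmorph_root.
  rewrite -eigenvalue_root_char => /eigenvalueP[v vS v0].
  have := Spos v^T; rewrite trmx_eq0 => /(_ v0).
  rewrite /quad_form trmxK vS -scalemxAl mxE pmulr_lgt0//.
  by have := sq_norm_gt0 v^T; rewrite /sq_norm trmxK trmx_eq0 v0.
(* [p] evaluated at [SC] is conjugate to the diagonal matrix of the values of [p] at the [l i], all
   zero. *)
apply: (@map_mx_inj _ _ f); rewrite map_mx0 map_horner_mx -/SC SCE.
rewrite horner_mx_uconjC// horner_mx_diag.
suff -> : map_mx (horner (map_poly f p)) sp = 0.
  by rewrite linear0 mulmx0 mul0mx.
apply/rowP => i; rewrite !mxE -lE horner_map /= pl ?rmorph0//.
by apply: map_f; rewrite mem_enum.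
Qed.

(* With [t] interpolating fourth roots of the eigenvalues of [S], the square
   root [t(S)^2] of [S] is visibly positive. *)
Lemma posdefmx_sqrt d (S : 'M[R]_d) :
  posdefmx S -> exists B : 'M[R]_d, posdefmx B /\ B *m B = S.
Proof.
case: d S => [|n] S Spd.
  by exists S; split=> //; rewrite [RHS]flatmx0 [LHS]flatmx0.
have [rs [rs0 rsS]] := posdefmx_spectrum _ _ Spd.
have [t tE] := interpolation _ rs (fun a => Num.sqrt (Num.sqrt a)).
set T := horner_mx S t.
have TS : T ^+ 4 = S.
  have := rsS (t ^+ 4 - 'X); rewrite rmorphB rmorphXn /= horner_mx_X.
  move=> /(_ _)/subr0_eq; apply => a ars; rewrite !hornerE tE//.
  by rewrite (exprM _ 2 2) !sqr_sqrtr ?sqrtr_ge0 ?ltW ?rs0// subrr.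
have Tt : T^T = T by rewrite trmx_horner_mx (proj1 Spd).
have Tu : T \in unitmx.
  have := posdefmx_unit _ Spd; rewrite -TS exprSr -mulmxE unitmx_mul.
  by case/andP.
exists (T *m T); split; last by rewrite -TS mulmxE -!expr2 -exprM.
split=> [|v v0]; first by rewrite trmx_mul Tt.
rewrite -{1}Tt quad_form_trmul sq_norm_gt0.
apply: contraNneq v0 => /(congr1 (mulmx (invmx T))).
by rewrite mulKmx// mulmx0 => ->.
Qed.

(** Existence of a root keeps [xget] from returning its default [0]. *)
Lemma sqrtmxP d (S : 'M[R]_d) :
  posdefmx S -> posdefmx (sqrtmx S) /\ sqrtmx S *m sqrtmx S = S.
Proof. by move=> /posdefmx_sqrt; exact: xgetPex. Qed.

Lemma posdefmx_det_gt0 d (S : 'M[R]_d) : posdefmx S -> 0 < \det S.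
Proof.
move=> Spd; have [_ <-] := sqrtmxP _ _ Spd.
rewrite det_mulmx -expr2 exprn_even_gt0//=.
by rewrite -unitfE -unitmxE posdefmx_unit//; case: (sqrtmxP _ _ Spd).
Qed.

(** The inverse root is symmetric with square [invmx S], so the square root disappears from the
    likelihood. *)
Lemma sq_norm_whiten d (S : 'M[R]_d) (w : 'cV[R]_d) : posdefmx S ->
  sq_norm (invmx (sqrtmx S) *m w) = quad_form (invmx S) w.
Proof.
move=> Spd; have [[Bt Bpos] BB] := sqrtmxP _ _ Spd.
have Bu : sqrtmx S \in unitmx by exact: posdefmx_unit.
rewrite -quad_form_trmul trmx_inv Bt; congr quad_form.
apply: (can_inj (mulKmx (posdefmx_unit _ Spd))).
by rewrite mulmxV ?posdefmx_unit// -{1}BB -!mulmxA (mulmxA (sqrtmx S) (invmx _))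
  mulmxV// mul1mx mulmxV.
Qed.

End square_root.

(** One block matrix has two factorizations into block-triangular matrices; compare their
    determinants. *)
Lemma det_rank1_update (R : comNzRingType) n (u : 'cV[R]_n) (v : 'rV[R]_n) :
  \det (1%:M + u *m v) = 1 + (v *m u) 0 0.
Proof.
have E : block_mx 1%:M (- u) v 1%:M =
    block_mx 1%:M 0 v 1%:M *m block_mx 1%:M (- u) 0 (1%:M + v *m u).
  by rewrite mulmx_block !(mul1mx, mul0mx, mulmx1, mulmx0, addr0, add0r)
    mulmxN addrC addrK.
have E' : block_mx 1%:M (- u) v 1%:M =
    block_mx (1%:M + u *m v) (- u) 0 1%:M *m block_mx 1%:M 0 v 1%:M.
  by rewrite mulmx_block !(mul1mx, mul0mx, mulmx1, mulmx0, addr0, add0r)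
    mulNmx addrK.
have := congr1 determinant (etrans (esym E') E).
rewrite !det_mulmx !det_ublock !det_lblock !det1 !mul1r !mulr1 => ->.
by rewrite det_mx11 !mxE eqxx.
Qed.

(** * One-variable derivatives at 0 *)

Lemma is_derive_right_max (R : realType) (f : R -> R) (l : R) :
  is_derive (0 : R) (1 : R) f l ->
  (\forall t \near (0 : R), f t <= f 0) -> l <= 0.
Proof.
move=> [fd <-] fmax; rewrite ['D_1 f 0]cvg_at_rightE; last exact: fd.
apply: limr_le; first exact: cvgP (cvg_dnbhs_at_right fd).
have {}fmax : \forall h \near 0^'+, f h <= f 0 by exact: cvg_within fmax.
near=> h; apply: mulr_ge0_le0.
  by rewrite invr_ge0; near: h; exact: nbhs_right_ge.
by rewrite /= addr0 [_%:A]mulr1 subr_le0; near: h.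
Unshelve. all: by end_near. Qed.

(** The one-sided bound applies to [f] and to its reflection, whose derivative is [- l]. *)
Lemma is_derive_local_max (R : realType) (f : R -> R) (l : R) :
  is_derive (0 : R) (1 : R) f l ->
  (\forall t \near (0 : R), f t <= f 0) -> l = 0.
Proof.
move=> fl fmax; apply/eqP; rewrite eq_le (is_derive_right_max _ _ _ fl fmax)/=.
rewrite -oppr_le0 -[- l]mulrN1; apply: (@is_derive_right_max _ (f \o -%R)).
  by apply: is_derive1_comp; rewrite oppr0.
rewrite /= oppr0.
suff : (fun t => - t) @ (0 : R) --> (0 : R) by move/(_ _ fmax).
by rewrite -[X in _ --> X]oppr0; apply: cvgN; exact: cvg_id.
Qed.

Lemma is_derive_even (R : realType) (f : R -> R) (l : R) :
  (forall x, f (- x) = f x) -> is_derive (0 : R) (1 : R) f l -> l = 0.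
Proof.
move=> feven fl.
have : is_derive (0 : R) (1 : R) (f \o -%R) (l * -1).
  by apply: is_derive1_comp; rewrite oppr0.
have -> : f \o -%R = f by apply/funext => x /=; rewrite feven.
by move=> [_]; rewrite (@derive_val _ _ _ _ _ _ _ fl); lra.
Qed.

(** The difference quotient at [0] is [b + t * c], which is continuous in [t]. *)
Lemma is_derive_quadratic (R : realType) (a b c : R) :
  is_derive (0 : R) (1 : R) (fun t => a + t * b + t ^+ 2 * c) b.
Proof.
apply/is_derive1_caratheodory; exists (fun t => b + t * c); split => [t||].
- by ring.
- apply: cvgD; first exact: cvg_cst.
  by apply: cvgMr_tmp; exact: cvg_id.
- by rewrite mul0r addr0.
Qed.

(** * The radial profile and its logarithmic derivative *)

Section radial_profile.
Context {R : realType} {n : nat}.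
Variables (phi : 'cV[R]_n.+1 -> R) (psi : R -> R).
Hypotheses (phi_elliptical : elliptical phi psi)
  (phi_pos : forall w, 0 < phi w)
  (phi_derivable : forall w, derivable phi w (delta_mx 0 0)).

(** The restriction of [phi] to the first axis. It inherits differentiability from [phi] everywhere,
    whereas [psi] does so only on positive arguments. *)
Let G (s : R) : R := psi (s ^+ 2).

Let GE s : G s = phi (s *: delta_mx 0 0).
Proof.
rewrite phi_elliptical /G sq_normE big_ord_recl big1 ?addr0; last first.
  by move=> i _; rewrite !mxE /= mulr0 expr0n.
by rewrite !mxE !eqxx mulr1.
Qed.

Let psiE z : 0 <= z -> psi z = G (Num.sqrt z).
Proof. by move=> z0; rewrite /G sqr_sqrtr. Qed.

Lemma elliptical_gt0 z : 0 <= z -> 0 < psi z.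
Proof. by move=> z0; rewrite psiE// GE. Qed.

Let G_derivable s : derivable G s 1.
Proof.
have := phi_derivable (s *: delta_mx 0 0); rewrite /derivable.
rewrite (_ : (fun h : R => _) =
    fun h : R => h^-1 *: ((G \o shift s) (h *: 1) - G s))//.
by apply/funext => h /=; rewrite !GE -scalerDl [_%:A]mulr1.
Qed.

Let G_derive0 : is_derive (0 : R) (1 : R) G 0.
Proof.
have G0 := derivableP (G_derivable 0); apply: (is_derive_eq G0).
by apply: (is_derive_even _ _ _ _ G0) => s; rewrite /G sqrrN.
Qed.

(** Near a positive [z], [psi] is [G \o Num.sqrt], a composition of differentiable functions. The
    half cancels the factor 2 in [rho]. *)
Lemma is_derive_ln_elliptical z : 0 < z ->
  is_derive (z : R) (1 : R) (fun z => ln (psi z)) (rho psi z / 2).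
Proof.
move=> z0; have psi0 : 0 < psi z by rewrite elliptical_gt0 ?ltW.
have psid : derivable psi z 1.
  apply: (@near_eq_derivable _ _ _ (G \o Num.sqrt)).
    near=> y; rewrite /= -psiE//; near: y.
    by apply: filterS (lt_nbhsr z0) => y /ltW.
  have := derivableP (G_derivable (Num.sqrt z)).
  by move=> /is_derive1_comp/(_ (is_derive1_sqrt z0))[].
have -> : rho psi z / 2 = (psi z)^-1 * derive1 psi z.
  by rewrite /rho; field; exact: lt0r_neq0.
apply: (@is_derive1_comp _ (@ln R)); first exact: is_derive1_ln.
by rewrite derive1E; exact: derivableP.
Unshelve. all: by end_near. Qed.

(* At [r = 0] the profile need not be differentiable, but it is evaluated
   along [t^2], where evenness of the density makes the derivative vanish. *)
Lemma is_derive_ln_quad_form m (P : 'M[R]_m) (r w : 'cV[R]_m) : posdefmx P ->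
  is_derive (0 : R) (1 : R) (fun t => ln (psi (quad_form P (r - t *: w))))
    (- rho psi (quad_form P r) * (r^T *m P *m w) 0 0).
Proof.
move=> Ppd; set b := (r^T *m P *m w) 0 0 : R.
have qE t : quad_form P (r - t *: w) =
    quad_form P r + t * (- 2 * b) + t ^+ 2 * quad_form P w.
  rewrite -scaleNr quad_formDr ?(proj1 Ppd)// quad_formZr -scalemxAr mxE -/b.
  by ring.
under eq_fun do rewrite qE.
have [r0|r0] := eqVneq r 0.
  have -> : b = 0 by rewrite /b r0 trmx0 !mul0mx mxE.
  (* The form is now [(t * c) ^+ 2], so its image under [psi] is [G (t * c)], and [G] has derivative
     0 at 0. *)
  rewrite r0 quad_form0 !mulr0; set c := Num.sqrt (quad_form P w).
  rewrite [X in is_derive _ _ X _](_ : _ =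
      (@ln R \o G) \o (fun t => 0 + t * c + t ^+ 2 * 0)); last first.
    apply/funext => t /=; congr (ln (psi _)).
    rewrite -[quad_form P w]sqr_sqrtr ?posdefmx_ge0// -/c; ring.
  rewrite -[X in is_derive _ _ _ X](mul0r c).
  apply: is_derive1_comp; last exact: is_derive_quadratic.
  rewrite expr0n !mul0r !addr0 -[X in is_derive _ _ _ X](mulr0 (G 0)^-1).
  by apply: is_derive1_comp => //; apply: is_derive1_ln; rewrite GE.
have z0 : 0 < quad_form P r by exact: (proj2 Ppd).
set z := quad_form P r in z0 *.
have -> : - rho psi z * b = rho psi z / 2 * (- 2 * b) by field.
apply: (@is_derive1_comp _ (fun z => ln (psi z))); last first.
  exact: is_derive_quadratic.
by rewrite expr0n !mul0r !addr0; exact: is_derive_ln_elliptical.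
Qed.

End radial_profile.

(** * The log-likelihood and its first-order conditions *)

Lemma mean_loglikE (R : realType) d (phi : 'cV[R]_d -> R) psi N
    (x x' : 'I_N -> 'cV[R]_d) (A S : 'M[R]_d) :
  elliptical phi psi -> (forall w, 0 < phi w) -> posdefmx S ->
  mean_loglik phi x x' A S = N%:R^-1 * \sum_i
    (ln (psi (quad_form (invmx S) (x' i - A *m x i))) - ln (\det S) / 2).
Proof.
move=> phiE phi0 Spd; congr (_ * _); apply: eq_bigr => i _.
rewrite /transition_density lnM ?posrE ?powR_gt0 ?posdefmx_det_gt0//.
by rewrite ln_powR phiE sq_norm_whiten//; field.
Qed.

(** The trace is the sum of the squares of all entries. This turns one vanishing derivative into a
    matrix equation. *)
Lemma mulmx_trmx_eq0 (R : realDomainType) m n (M : 'M[R]_(m, n)) :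
  \tr (M *m M^T) = 0 -> M = 0.
Proof.
have sq_ge0 i : 0 <= (M *m M^T) i i.
  by rewrite mxE sumr_ge0// => j _; rewrite mxE -expr2 sqr_ge0.
move=> /psumr_eq0P MM; apply/matrixP => i j; rewrite [RHS]mxE.
have : \sum_j M i j ^+ 2 = 0.
  transitivity ((M *m M^T) i i); last by rewrite MM.
  by rewrite [RHS]mxE; apply: eq_bigr => k _; rewrite [_^T k i]mxE.
move=> /psumr_eq0P Mi; apply/eqP; rewrite -sqrf_eq0 Mi// => k _.
exact: sqr_ge0.
Qed.

Section first_order_conditions.
Context {R : realType} {n N : nat}.
Variables (phi : 'cV[R]_n.+1 -> R) (psi : R -> R).
Hypotheses (phi_elliptical : elliptical phi psi)
  (phi_pos : forall w, 0 < phi w)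
  (phi_derivable : forall w, derivable phi w (delta_mx 0 0)).
Variables (x x' : 'I_N -> 'cV[R]_n.+1) (A S : 'M[R]_n.+1).
Hypotheses (N_gt0 : (0 < N)%N) (AS_mle : is_mle phi x x' A S).

Let r i := x' i - A *m x i.
Let rho_ i := rho psi (quad_form (invmx S) (r i)).

Let loglik_le A0 S0 : posdefmx S0 ->
  \sum_i (ln (psi (quad_form (invmx S0) (x' i - A0 *m x i))) - ln (\det S0) / 2)
  <= \sum_i (ln (psi (quad_form (invmx S) (r i))) - ln (\det S) / 2).
Proof.
move=> S0pd; have [Spd /(_ A0 S0 S0pd)] := AS_mle.
by rewrite !(mean_loglikE _ _ _ psi)// ler_pM2l// invr_gt0 ltr0n.
Qed.

(** The choice [H = S *m M] makes the derivative of [f] at 0 equal to minus the trace of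
    [M *m M^T]. *)
Lemma mle_score_regression : \sum_i rho_ i *: (r i *m (x i)^T) = 0.
Proof.
have Spd := AS_mle.1; have Su := posdefmx_unit _ Spd.
set M := \sum_i _; pose H := S *m M.
pose f (t : R) := \sum_i ln (psi (quad_form (invmx S) (r i - t *: (H *m x i)))).
have fmax t : f t <= f 0.
  (* [S] is kept fixed, so the log-determinants cancel. *)
  have := loglik_le (A + t *: H) S Spd; rewrite !sumrB lerBlDr subrK.
  congr (_ <= _); apply: eq_bigr => i _; congr (ln (psi (quad_form _ _))).
    by rewrite mulmxDl -scalemxAl opprD addrA.
  by rewrite scale0r subr0.
have fd : is_derive (0 : R) (1 : R) f
    (\sum_i - rho_ i * ((r i)^T *m invmx S *m (H *m x i)) 0 0).
  rewrite (_ : f = \sum_i (fun t =>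
      ln (psi (quad_form (invmx S) (r i - t *: (H *m x i)))))); last first.
    by apply/funext => t; rewrite fct_sumE.
  apply: is_derive_sum => i.
  by apply: is_derive_ln_quad_form => //; exact: posdefmx_inv.
have near_fmax : \forall t \near (0 : R), f t <= f 0.
  by near=> t; exact: fmax.
have := is_derive_local_max _ _ _ fd near_fmax.
move=> /eqP; rewrite -oppr_eq0 -sumrN => /eqP E.
apply: mulmx_trmx_eq0; rewrite -[RHS]E.
rewrite {2}/M linear_sum mulmx_sumr linear_sum /=; apply: eq_bigr => i _.
rewrite linearZ /= trmx_mul trmxK -scalemxAr linearZ /= mulNr opprK.
(* The factor [S] in [H] cancels [invmx S], and cyclicity of the trace yields [r_i^T M x_i]. *)
rewrite /H !mulmxA mulmxKV// mxtrace_mulC mulmxA.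
by rewrite /mxtrace big_ord1.
Unshelve. all: by end_near. Qed.

(** Both sides are symmetric, so their forms are compared at each [v]. The derivative along the
    curve attached to [v] is half of [\sum_i rho_ i * c i ^+ 2] plus [N q]. *)
Lemma mle_score_scatter : S = - (N%:R^-1 *: \sum_i rho_ i *: (r i *m (r i)^T)).
Proof.
have Spd := AS_mle.1; have Su := posdefmx_unit _ Spd.
apply: quad_form_inj => [||v]; first exact: Spd.1.
  rewrite [LHS]linearN /= [(_ *: _)^T]linearZ /= linear_sum /=.
  congr (- (_ *: _)); apply: eq_bigr => i _.
  by rewrite [LHS]linearZ /= trmx_mul trmxK.
rewrite quad_formN quad_formZ quad_form_sum.
set q := quad_form S v; pose c i : R := ((r i)^T *m v) 0 0.
pose z i := quad_form (invmx S) (r i).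
have -> : \sum_i quad_form (rho_ i *: (r i *m (r i)^T)) v =
    \sum_i rho_ i * c i ^+ 2.
  by apply: eq_bigr => i _; rewrite quad_formZ quad_form_rank1.
(* The log-likelihood sum along the curve, with the constant [ln (\det S) / 2] added to each
   term. *)
pose f (t : R) := \sum_i (ln (psi (z i + t * c i ^+ 2)) + ln (1 + t * q) / 2).
(* This condition ensures that the curve stays positive definite, so the comparison is made only for
   small [t]. *)
have tq_gt0 : \forall t \near (0 : R), 0 < 1 + t * q.
  have : (fun t : R => 1 + t * q) @ (0 : R) --> (1 + 0 * q : R).
    apply: cvgD; first exact: cvg_cst.
    by apply: cvgMr_tmp; exact: cvg_id.
  by move=> /cvgr_gt; apply; rewrite mul0r addr0.
have fmax : \forall t \near (0 : R), f t <= f 0.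
  near=> t.
  have tq : 0 < 1 + t * q by near: t.
  have Ppd := posdefmx_rank1_update _ _ _ Spd tq.
  have := loglik_le A _ (posdefmx_inv _ Ppd).
  rewrite invmxK det_inv.
  have -> : \det (invmx S + t *: (v *m v^T)) = (1 + t * q) / \det S.
    (* Factoring out [invmx S] leaves a rank-one perturbation of the identity. *)
    have -> : invmx S + t *: (v *m v^T) =
        invmx S *m (1%:M + (t *: (S *m v)) *m v^T).
      by rewrite mulmxDr mulmx1 -scalemxAl -scalemxAr -mulmxA mulKmx.
    rewrite det_mulmx det_rank1_update det_inv mulrC -scalemxAr mxE mulmxA.
    by rewrite /q.
  have detS := posdefmx_det_gt0 _ _ Spd.
  rewrite lnV ?posrE ?divr_gt0// ln_div ?posrE//.
  rewrite -(lerD2r (\sum_(i < N) ln (\det S) / 2)) -!big_split /=.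
  congr (_ <= _); apply: eq_bigr => i _.
    rewrite quad_formD quad_formZ quad_form_rank1 -/(r i) -/(z i).
    rewrite (_ : (v^T *m r i) 0 0 = c i); first by field.
    by rewrite -trmx11 trmx_mul trmxK.
  by rewrite !mul0r !addr0 ln1 mul0r addr0 subrK.
have fd : is_derive (0 : R) (1 : R) f (\sum_i (rho_ i / 2 * c i ^+ 2 + q / 2)).
  rewrite (_ : f = \sum_i ((fun t => ln (psi (z i + t * c i ^+ 2))) +
      (fun t => ln (1 + t * q) / 2))); last first.
    by apply/funext => t; rewrite fct_sumE.
  apply: is_derive_sum => i; apply: is_deriveD.
    (* A zero residual makes the term constant; this case is separate since [psi] may fail to be
       differentiable at [z i = 0]. *)
    have [r0|r0] := eqVneq (r i) 0.
      have -> : c i = 0 by rewrite /c r0 trmx0 mul0mx mxE.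
      rewrite expr0n mulr0; under eq_fun do rewrite mulr0.
      exact: is_derive_cst.
    apply: (@is_derive1_comp _ (fun z => ln (psi z))).
      rewrite mul0r addr0; apply: (is_derive_ln_elliptical phi) => //.
      exact: (posdefmx_inv _ Spd).2.
    rewrite (_ : (fun _ => _) = fun t : R => z i + t * c i ^+ 2 + t ^+ 2 * 0).
      exact: is_derive_quadratic.
    by apply/funext => t; rewrite mulr0 addr0.
  rewrite (_ : (fun _ => _) =
      2^-1 \*: (fun t : R => ln (1 + t * q))); last first.
    by apply/funext => t; rewrite /= mulrC.
  rewrite mulrC; apply: is_deriveZ; rewrite -[q in X in is_derive _ _ _ X]mul1r.
  apply: (@is_derive1_comp _ (@ln R)).
    by rewrite mul0r addr0 -[X in is_derive _ _ _ X]invr1; exact: is_derive1_ln.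
  rewrite (_ : (fun _ => _) = fun t : R => 1 + t * q + t ^+ 2 * 0).
    exact: is_derive_quadratic.
  by apply/funext => t; rewrite mulr0 addr0.
have := is_derive_local_max _ _ _ fd fmax.
rewrite big_split /= sumr_const card_ord -mulr_natr.
under eq_bigr do rewrite mulrAC.
rewrite -mulr_suml => E; have NR0 : N%:R != 0 :> R by rewrite pnatr_eq0 -lt0n.
set s := \sum_i _ in E *; apply: (mulfI NR0).
rewrite mulrN mulVKf//; apply/eqP; rewrite -subr_eq0 -(mulr0 2) -E.
by apply/eqP; field.
Unshelve. all: by end_near. Qed.

End first_order_conditions.

(** * From the first-order conditions to the estimator *)

Theorem corollary1 (R : realType) (d N : nat)
    (phi : 'cV[R]_d -> R) (psi : R -> R)
    (phi_density : is_density phi)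
    (phi_elliptical : elliptical phi psi)
    (phi_pos : forall w : 'cV[R]_d, 0 < phi w)
    (phi_C2 : continuously_differentiable 2 phi)
    (phi_moment : finite_first_moment phi)
    (x x' : 'I_N -> 'cV[R]_d)
    (A S : 'M[R]_d)
    (AS_mle : is_mle phi x x' A S) :
  let r := fun i : 'I_N => x' i - A *m x i in
  let rho_ := fun i : 'I_N => rho psi (quad_form (invmx S) (r i)) in
  posdefmx (- \sum_(i < N) rho_ i *: (x i *m (x i)^T)) ->
  A = (\sum_(i < N) rho_ i *: (x' i *m (x i)^T))
        *m invmx (\sum_(i < N) rho_ i *: (x i *m (x i)^T))
  /\ S = - (N%:R^-1 *: \sum_(i < N) rho_ i *: (r i *m (r i)^T)).
Proof.
(* In dimension 0 all matrices coincide; a positive dimension supplies the first axis. *)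
case: d => [|n] in phi phi_density phi_elliptical phi_pos phi_C2 phi_moment
  x x' A S AS_mle *.
  by move=> r rho_ _; split; rewrite [LHS]flatmx0 [RHS]flatmx0.
move=> r rho_ Wpd.
(* Without data the weighted sum would be the zero matrix, which is not positive definite in
   positive dimension. *)
have N_gt0 : (0 < N)%N.
  rewrite lt0n; apply/eqP => N0; have [_ /(_ (delta_mx 0 0))] := Wpd.
  rewrite quad_formN quad_form_sum big1 => [|i _]; last first.
    by have := ltn_ord i; rewrite {2}N0.
  rewrite oppr0 ltxx => /(_ _)/negP; apply => //.
  by apply/eqP => /matrixP/(_ 0 0)/eqP; rewrite !mxE !eqxx oner_eq0.
have phid w : derivable phi w (delta_mx 0 0) by have [_ /(_ 0)[]] := phi_C2.
split; last exact: mle_score_scatter.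
set W := \sum_(i < N) _ in Wpd *.
have Wu : W \in unitmx.
  by have : - W \is a GRing.unit := posdefmx_unit _ Wpd; rewrite unitrN.
(* After multiplication by [W], the formula for [A] is the first score equation with the residuals
   expanded. *)
apply: (can_inj (mulmxK Wu)); rewrite mulmxKV//; apply/esym/eqP.
rewrite -subr_eq0 mulmx_sumr -sumrB; apply/eqP.
rewrite -[RHS](mle_score_regression _ _ phi_elliptical phi_pos phid _ _ _ _
  N_gt0 AS_mle).
by apply: eq_bigr => i _; rewrite -scalemxAr -scalerBr mulmxBl mulmxA.
Qed.
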